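(* Suppose there exist Gaussian integers $x,y,z\in\mathbb{Z}[\sqrt{-1}]$ such that $$\mathrm{Im}[x^4y^4z^4]=-4\,\mathrm{Im}[x^4]\,\mathrm{Im}[y^4]\,\mathrm{Im}[z^4],$$ such that none of $x^4,y^4,z^4$ is real, and such that no two of $x^4,y^4,z^4$ are real multiples of each other. Then there exists a magic hourglass of squares.
   Context: A magic hourglass of squares consists of seven distinct squared integers $a^2,b^2,c^2,e^2,g^2,h^2,i^2$ (with $a,b,c,e,g,h,i\in\mathbb{Z}$), arranged as $$\begin{bmatrix} a^2&b^2&c^2\\ -&e^2&-\\ g^2&h^2&i^2\end{bmatrix},$$ such that for some integer $T$, $$a^2+e^2+i^2=b^2+e^2+h^2=c^2+e^2+g^2=T\quad\text{and}\quad a^2+b^2+c^2=g^2+h^2+i^2=T.$$ Here the entry $i$ is an integer; the imaginary unit is written $\sqrt{-1}$. *)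

(* Defs.v *)
From HB Require Import structures.
From mathcomp Require Import all_boot all_order all_algebra.
From mathcomp Require Import reals complex.

Set Implicit Arguments.
Unset Strict Implicit.
Unset Printing Implicit Defensive.

Import Order.TTheory GRing.Theory Num.Theory.
Local Open Scope ring_scope.
Local Open Scope complex_scope.

(* The complex field is R[i], where R : realType is the field of reals; its
   elements m +i* n with m and n integers form the ring Z[sqrt(-1)].
   complex.Re and complex.Im are R-valued; unqualified, Re and Im denote the
   R[i]-valued operators of numClosedFieldType. *)
Definition gaussian_int (R : realType) : {pred R[i]} :=
  [pred z | (complex.Re z \is a Num.int) && (complex.Im z \is a Num.int)].

Arguments gaussian_int : clear implicits.

Definition real_multiples (R : realType) (u v : R[i]) : Prop :=
  (exists r : R, u = r%:C * v) /\ (exists r : R, v = r%:C * u).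

Definition magic_hourglass_of_squares (a b c e g h i : int) : Prop :=
  uniq [:: a ^+ 2; b ^+ 2; c ^+ 2; e ^+ 2; g ^+ 2; h ^+ 2; i ^+ 2] /\
  exists T : int,
    [/\ a ^+ 2 + e ^+ 2 + i ^+ 2 = T,
        b ^+ 2 + e ^+ 2 + h ^+ 2 = T,
        c ^+ 2 + e ^+ 2 + g ^+ 2 = T,
        a ^+ 2 + b ^+ 2 + c ^+ 2 = T
      & g ^+ 2 + h ^+ 2 + i ^+ 2 = T].

(* Main.v *)
Require Import Defs.
From mathcomp Require Import all_boot all_order all_algebra.
From mathcomp Require Import reals complex.
From mathcomp Require Import ring lra zify.

Import Order.TTheory GRing.Theory Num.Theory.
Local Open Scope ring_scope.
Local Open Scope complex_scope.

(** An hourglass with centre e ^ 2 has T = 3 * e ^ 2, and its three pairs of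
    opposite corners or edges are e ^ 2 - p and e ^ 2 + p, e ^ 2 - q and
    e ^ 2 + q, e ^ 2 - r and e ^ 2 + r.  The two rows sum to T exactly when
    p + q + r = 0.  A Gaussian integer u produces such a pair: if
    u ^ 2 = s + t * sqrt (-1), then s ^ 2 + t ^ 2 = |u| ^ 4 and
    Im (u ^ 4) = 2 * s * t, so that (s - t) ^ 2 and (s + t) ^ 2 are
    |u| ^ 4 - Im (u ^ 4) and |u| ^ 4 + Im (u ^ 4)
    ([square_offsets_of_gaussian]).  It therefore suffices to find three
    Gaussian integers of the same modulus with Im (u ^ 4) + Im (v ^ 4) +
    Im (w ^ 4) = 0.

    The hypothesis provides them.  For angles A, B, C,
      sin (A + B - C) + sin (A - B + C) + sin (- A + B + C)
        = sin (A + B + C) + 4 * sin A * sin B * sin C,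
    and with A, B, C the arguments of x ^ 4, y ^ 4, z ^ 4 the right-hand side
    vanishes.  So u, v, w are the products of x, y, z in which one factor is
    conjugated ([Im_mul_conj_sum]).

    For the seven squares to be distinct, the offsets p, q, r must be nonzero
    and distinct.  By the product formulas,
      sin (A + B - C) - sin (A - B + C) = 2 * cos A * sin (B - C),
      sin (A - B + C) + sin (- A + B + C) = 2 * sin C * cos (A - B),
    where sin (B - C) and sin C are nonzero by assumption.  The cosines are
    those of arguments of fourth powers of Gaussian integers, and such a power
    is never purely imaginary: otherwise sqrt 2 would be rational
    ([Re_gaussian_exp4_neq0]). *)

Lemma magic_hourglass_of_offsets (a b c e g h i p q r : int) :
  a ^+ 2 = e ^+ 2 - p -> i ^+ 2 = e ^+ 2 + p ->
  b ^+ 2 = e ^+ 2 - q -> h ^+ 2 = e ^+ 2 + q ->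
  c ^+ 2 = e ^+ 2 - r -> g ^+ 2 = e ^+ 2 + r ->
  p + q + r = 0 -> p <> 0 -> q <> 0 -> r <> 0 ->
  p <> q -> p <> r -> q <> r ->
  magic_hourglass_of_squares a b c e g h i.
Proof.
rewrite /magic_hourglass_of_squares.
move=> -> -> -> -> -> -> pqr p0 q0 r0 pq pr qr.
move: (e ^+ 2) => E; split.
  by rewrite /= !inE !negb_or !andbT; do ?[apply/andP; split]; lia.
exists (3 * E); split; lia.
Qed.

Definition sqnorm {R : rcfType} (u : R[i]) : R :=
  complex.Re u ^+ 2 + complex.Im u ^+ 2.

Lemma sqnormM (R : rcfType) (u v : R[i]) :
  sqnorm (u * v) = sqnorm u * sqnorm v.
Proof. by case: u v => [a b] [c d]; rewrite /sqnorm /=; ring. Qed.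

Lemma sqnorm_conj (R : rcfType) (u : R[i]) : sqnorm u^* = sqnorm u.
Proof. by case: u => a b; rewrite /sqnorm /=; ring. Qed.

Lemma gaussian_intP (R : realType) (u : R[i]) :
  u \in gaussian_int R -> exists m n : int, u = m%:~R +i* n%:~R.
Proof.
by case: u => a b /andP[/= /intrP[m ->] /intrP[n ->]]; exists m, n.
Qed.

Lemma gaussian_intM (R : realType) (u v : R[i]) :
  u \in gaussian_int R -> v \in gaussian_int R -> u * v \in gaussian_int R.
Proof.
case: u v => [a b] [c d] /andP[/= ha hb] /andP[/= hc hd].
by rewrite inE /= ?rpredB ?rpredD ?rpredM.
Qed.

Lemma gaussian_int_conj (R : realType) (u : R[i]) :
  u \in gaussian_int R -> u^* \in gaussian_int R.
Proof. by case: u => a b /andP[/= ha hb]; rewrite inE /= rpredN ha. Qed.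

Lemma square_offsets_of_gaussian (R : realType) (u : R[i]) (e : int) :
  u \in gaussian_int R -> sqnorm u = e%:~R ->
  exists a i p : int, [/\ a ^+ 2 = e ^+ 2 - p, i ^+ 2 = e ^+ 2 + p
    & p%:~R = complex.Im (u ^+ 4)].
Proof.
move=> /gaussian_intP[m [n ->]].
have -> : sqnorm (m%:~R +i* n%:~R) = (m ^+ 2 + n ^+ 2)%:~R :> R.
  by rewrite /sqnorm /= rmorphD !rmorphXn.
move=> /intr_inj <-.
pose s := m ^+ 2 - n ^+ 2; pose t := 2 * m * n.
exists (s - t), (s + t), (2 * s * t); rewrite /s /t; split; [ring|ring|].
by rewrite /= !(rmorphM, rmorphB, rmorphXn) /=; ring.
Qed.

(** For n nonzero, the 2-adic valuations of the two sides have different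
    parities. *)
Lemma sqr_eq_double_sqr (m n : int) : m ^+ 2 = 2 * n ^+ 2 -> m = 0.
Proof.
move=> mn; have [->//|m0] := eqVneq m 0.
have n0 : n != 0 by apply: contra_neq m0 => n0; move: mn; rewrite n0; nia.
have /(congr1 (fun k => odd (logn 2 k))) : (`|m| ^ 2 = 2 * `|n| ^ 2)%N by nia.
by rewrite lognM ?expn_gt0 ?absz_gt0 ?n0 // !lognX oddD !oddM.
Qed.

(** If u ^ 2 = s + t * sqrt (-1) and Re (u ^ 4) = s ^ 2 - t ^ 2 vanished, then
    sqnorm u ^ 2 = s ^ 2 + t ^ 2 would be twice a square. *)
Lemma Re_gaussian_exp4_neq0 (R : realType) (u : R[i]) :
  u \in gaussian_int R -> u != 0 -> complex.Re (u ^+ 4) != 0.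
Proof.
move=> /gaussian_intP[m [n ->]]; apply: contraNneq.
have -> : complex.Re ((m%:~R +i* n%:~R : R[i]) ^+ 4)
          = ((m ^+ 2 - n ^+ 2) ^+ 2 - (2 * m * n) ^+ 2)%:~R.
  by rewrite /= !(rmorphM, rmorphB, rmorphXn) /=; ring.
move=> /eqP; rewrite intr_eq0 => /eqP Re0.
have /sqr_eq_double_sqr mn0 :
  (m ^+ 2 + n ^+ 2) ^+ 2 = 2 * (m ^+ 2 - n ^+ 2) ^+ 2 by lia.
have [-> ->] : m = 0 /\ n = 0 by split; nia.
by rewrite eq_complex /= !eqxx.
Qed.

(** With A, B, C the arguments of X, Y, Z, these are trigonometric identities
    for sin (A + B - C), sin (A - B + C), sin (- A + B + C), multiplied by the
    product of the three moduli. *)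
Section SineIdentities.
Variables (R : rcfType) (X Y Z : R[i]).
Let p := complex.Im (X * Y * Z^*).
Let q := complex.Im (X * Z * Y^*).
Let r := complex.Im (Y * Z * X^*).

Lemma Im_mul_conj_sum :
  p + q + r = complex.Im (X * Y * Z)
              + 4 * complex.Im X * complex.Im Y * complex.Im Z.
Proof.
by rewrite /p /q /r; case: X Y Z => [? ?] [? ?] [? ?] /=; ring.
Qed.

Lemma Im_mul_conj_add : q + r = 2 * complex.Im Z * complex.Re (X * Y^*).
Proof. by rewrite /q /r; case: X Y Z => [? ?] [? ?] [? ?] /=; ring. Qed.

Lemma Im_mul_conj_sub : p - q = 2 * complex.Re X * complex.Im (Y * Z^*).
Proof. by rewrite /p /q; case: X Y Z => [? ?] [? ?] [? ?] /=; ring. Qed.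

End SineIdentities.

Lemma Im_neq0_of_nonreal (R : rcfType) (u : R[i]) :
  u \isn't Num.real -> complex.Im u != 0.
Proof. by case: u => a b; rewrite complex_real. Qed.

Lemma Im_mul_conj_neq0 (R : realType) (u v : R[i]) :
  complex.Im u != 0 -> complex.Im v != 0 -> ~ real_multiples u v ->
  complex.Im (u * v^*) != 0.
Proof.
case: u v => [a b] [c d] /= b0 d0; apply: contra_notN => /eqP uv0.
have bc : b * c = a * d by lra.
split; [exists (b / d) | exists (d / b)]; apply/eqP.
  by rewrite eq_complex /= !mul0r subr0 addr0 mulrAC bc mulfK // divfK ?eqxx.
rewrite eq_complex /= !mul0r subr0 addr0 divfK // eqxx andbT.
by rewrite mulrAC [d * a]mulrC -bc mulrAC mulfV ?mul1r.
Qed.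

(** The hypothesis on x, y, z and its consequences are symmetric; these are
    the two kinds of nondegeneracy for one choice of the roles.  The offsets
    sum to zero, so that p vanishes only when q + r does. *)
Lemma offset_neq0 (R : rcfType) (X Y Z : R[i]) :
  complex.Im (X * Y * Z^*) + complex.Im (X * Z * Y^*)
    + complex.Im (Y * Z * X^*) = 0 ->
  complex.Im Z != 0 -> complex.Re (X * Y^*) != 0 ->
  complex.Im (X * Y * Z^*) != 0.
Proof.
rewrite -addrA Im_mul_conj_add => /eqP; rewrite addr_eq0 => /eqP -> Z0 XY0.
by rewrite oppr_eq0 !mulf_neq0 ?pnatr_eq0.
Qed.

Lemma offsets_neq (R : rcfType) (X Y Z : R[i]) :
  complex.Re X != 0 -> complex.Im (Y * Z^*) != 0 ->
  complex.Im (X * Y * Z^*) != complex.Im (X * Z * Y^*).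
Proof.
by move=> X0 YZ0; rewrite -subr_eq0 Im_mul_conj_sub !mulf_neq0 ?pnatr_eq0.
Qed.

Theorem theorem4p1 (R : realType) (x y z : R[i])
  (hx : x \in gaussian_int R) (hy : y \in gaussian_int R)
  (hz : z \in gaussian_int R)
  (him : complex.Im (x ^+ 4 * y ^+ 4 * z ^+ 4)
         = - 4 * complex.Im (x ^+ 4) * complex.Im (y ^+ 4) * complex.Im (z ^+ 4))
  (hxr : x ^+ 4 \isn't Num.real) (hyr : y ^+ 4 \isn't Num.real)
  (hzr : z ^+ 4 \isn't Num.real)
  (hxy : ~ real_multiples (x ^+ 4) (y ^+ 4))
  (hxz : ~ real_multiples (x ^+ 4) (z ^+ 4))
  (hyz : ~ real_multiples (y ^+ 4) (z ^+ 4)) :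
  exists a b c e g h i : int, magic_hourglass_of_squares a b c e g h i.
Proof.
have exp4_conj (u v : R[i]) : (u * v^*) ^+ 4 = u ^+ 4 * (v ^+ 4)^*.
  by rewrite exprMn rmorphXn.
have neq0 (u : R[i]) : u ^+ 4 \isn't Num.real -> u != 0.
  by apply: contraNneq => ->; rewrite expr0n real0.
have Re_neq0 (u : R[i]) : u \in gaussian_int R -> u ^+ 4 \isn't Num.real ->
    complex.Re (u ^+ 4) != 0.
  by move=> hu /neq0; apply: Re_gaussian_exp4_neq0.
have Re_conj_neq0 (u v : R[i]) : u \in gaussian_int R -> v \in gaussian_int R ->
    u ^+ 4 \isn't Num.real -> v ^+ 4 \isn't Num.real ->
    complex.Re (u ^+ 4 * (v ^+ 4)^*) != 0.
  move=> hu hv /neq0 u0 /neq0 v0; rewrite -exp4_conj Re_gaussian_exp4_neq0 //.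
    by rewrite gaussian_intM ?gaussian_int_conj.
  by rewrite mulf_neq0 ?conjc_eq0.
have [e eP] : exists e : int, sqnorm (x * y * z) = e%:~R.
  have /gaussian_intP[m [n ->]] : x * y * z \in gaussian_int R.
    by rewrite !gaussian_intM.
  by exists (m ^+ 2 + n ^+ 2); rewrite /sqnorm /= rmorphD !rmorphXn.
have [||a [i [p [aE iE pE]]]] := @square_offsets_of_gaussian R (x * y * z^*) e.
- by rewrite !gaussian_intM ?gaussian_int_conj.
- by rewrite -eP !sqnormM sqnorm_conj.
have [||b [h [q [bE hE qE]]]] := @square_offsets_of_gaussian R (x * z * y^*) e.
- by rewrite !gaussian_intM ?gaussian_int_conj.
- by rewrite -eP !sqnormM sqnorm_conj mulrAC.
have [||c [g [r [cE gE rE]]]] := @square_offsets_of_gaussian R (y * z * x^*) e.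
- by rewrite !gaussian_intM ?gaussian_int_conj.
- by rewrite -eP !sqnormM sqnorm_conj mulrC mulrA.
rewrite !exp4_conj !exprMn in pE qE rE.
move: (Re_neq0 _ hx hxr) (Re_neq0 _ hy hyr) (Re_neq0 _ hz hzr).
move: (Re_conj_neq0 _ _ hx hy hxr hyr) (Re_conj_neq0 _ _ hx hz hxr hzr)
      (Re_conj_neq0 _ _ hy hz hyr hzr).
move: hxr hyr hzr => /Im_neq0_of_nonreal hx0 /Im_neq0_of_nonreal hy0
  /Im_neq0_of_nonreal hz0.
move: (Im_mul_conj_neq0 _ _ _ hx0 hy0 hxy) (Im_mul_conj_neq0 _ _ _ hx0 hz0 hxz)
      (Im_mul_conj_neq0 _ _ _ hy0 hz0 hyz).
move: him hx0 hy0 hz0 pE qE rE.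
move: (x ^+ 4) (y ^+ 4) (z ^+ 4) => X Y Z.
move=> him hX0 hY0 hZ0 pE qE rE XY XZ YZ ReXY ReXZ ReYZ ReX ReY ReZ.
have pqr : p%:~R + q%:~R + r%:~R = 0 :> R.
  by rewrite pE qE rE Im_mul_conj_sum him; ring.
exists a, b, c, e, g, h, i.
(* Each nondegeneracy condition is one of the two lemmas after a permutation
   of the roles of X, Y, Z. *)
apply: (@magic_hourglass_of_offsets _ _ _ _ _ _ _ p q r) => //.
- by apply/eqP; rewrite -(intr_eq0 R) !rmorphD pqr.
- apply/eqP; rewrite -(intr_eq0 R) pE offset_neq0 // -pE -qE -rE //.
- apply/eqP; rewrite -(intr_eq0 R) qE offset_neq0 // [Z * Y]mulrC.
  by rewrite -pE -qE -rE -pqr; ring.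
- apply/eqP; rewrite -(intr_eq0 R) rE offset_neq0 // [Z * X]mulrC [Y * X]mulrC.
  by rewrite -pE -qE -rE -pqr; ring.
- by apply/eqP; rewrite -(inj_eq (@intr_inj R)) pE qE offsets_neq.
- apply/eqP; rewrite -(inj_eq (@intr_inj R)) pE rE [X * Y]mulrC.
  by rewrite offsets_neq.
- apply/eqP; rewrite -(inj_eq (@intr_inj R)) qE rE [X * Z]mulrC [Y * Z]mulrC.
  by rewrite offsets_neq.
Qed.
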